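(* If a shortest path graph $H$ has an induced claw $K_{1,3}$, then $H$ must have a $4$-cycle containing two edges of the induced claw. In particular, $K_{1,3}$ is not a shortest path graph.
   Context: Graphs are finite and simple. For a graph $G$ with distinct vertices $a,b$, a shortest $a,b$-path is a path between $a$ and $b$ of length $d_G(a,b)$. The shortest path graph $S(G,a,b)$ is the graph whose vertices are the shortest $a,b$-paths in $G$, two of them being adjacent if and only if the corresponding paths differ in exactly one vertex. A graph $H$ is called a shortest path graph if there exist a graph $G$ and distinct $a,b\in V(G)$ with $S(G,a,b)\cong H$. *)

(* Defs.v *)
From mathcomp Require Import all_boot.

Set Implicit Arguments.
Unset Strict Implicit.
Unset Printing Implicit Defensive.

Record sgraph := SGraph {
  vertex :> finType;
  adj : rel vertex;
  adj_sym : symmetric adj;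
  adj_irr : irreflexive adj }.
Arguments adj {s}.

Definition graph_iso (G H : sgraph) : Prop :=
  exists f : G -> H, bijective f /\ forall x y, adj (f x) (f y) = adj x y.

(* A path is given by its vertex sequence listed from [a] to [b], both ends
   included, so a path of length [k] is a sequence of size [k.+1]. *)
Definition ab_path (G : sgraph) (a b : G) (s : seq G) : bool :=
  if s is x :: p then [&& x == a, path adj x p, last x p == b & uniq s]
  else false.

(* The least length of an a,b-path.  Such a length is always [< #|G|]; the value
   [#|G|] plays the role of infinity when [a] and [b] are not connected. *)
Definition dist (G : sgraph) (a b : G) : nat :=
  \big[minn/#|G|]_(k < #|G| | [exists s : k.+1.-tuple G, ab_path a b s]) k.

Lemma ab_path_dist_le (G : sgraph) (a b : G) (s : seq G) :
  ab_path a b s -> dist a b <= (size s).-1.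
Proof.
case: s => [|x p] // sP; rewrite /dist /=.
have up : size p < #|G|.
  by case/and4P: sP => _ _ _ u; have := max_card (mem (x :: p)); rewrite (card_uniqP u).
have Pk : [exists s : (Ordinal up).+1.-tuple G, ab_path a b s].
  by apply/existsP; exists (in_tuple (x :: p)).
have := mem_index_enum (Ordinal up); elim: index_enum => // k r IH.
rewrite inE big_cons => /orP[/eqP<-|/IH{}IH]; first by rewrite Pk geq_minl.
by case: ifP => // _; rewrite geq_min IH orbT.
Qed.

Lemma ab_path_dist_attained (G : sgraph) (a b : G) (s : seq G) :
  ab_path a b s -> exists t : (dist a b).+1.-tuple G, ab_path a b t.
Proof.
move=> sP.
have lt_dist : dist a b < #|G|.
  apply: leq_ltn_trans (ab_path_dist_le sP) _.
  case: s sP => // x p /and4P[_ _ _ u].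
  by have := max_card (mem (x :: p)); rewrite (card_uniqP u).
suff: dist a b = #|G| \/ exists t : (dist a b).+1.-tuple G, ab_path a b t.
  by case=> // e; rewrite e ltnn in lt_dist.
rewrite {lt_dist sP s} /dist.
elim/big_ind: _ => [|m n Hm Hn|k /existsP]; [by left| |by right].
by rewrite /minn; case: ifP.
Qed.

Definition shortest_path (G : sgraph) (a b : G) : finType :=
  {s : (dist a b).+1.-tuple G | ab_path a b s}.

(* Paths are compared position by position.  The vertex in position [i] of a
   shortest a,b-path is at distance [i] from [a], so the number of
   positions where [p] and [q] disagree is the number of vertices of [p] that
   are not on [q], and vice versa. *)
Definition spg_adj (G : sgraph) (a b : G) : rel (shortest_path a b) :=
  fun p q => #|[set i | tnth (val p) i != tnth (val q) i]| == 1.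

Lemma spg_adj_sym (G : sgraph) (a b : G) : symmetric (@spg_adj G a b).
Proof.
move=> p q; rewrite /spg_adj; congr (#|pred_of_set _| == 1).
by apply/setP=> i; rewrite !inE eq_sym.
Qed.

Lemma spg_adj_irr (G : sgraph) (a b : G) : irreflexive (@spg_adj G a b).
Proof.
move=> p; rewrite /spg_adj (_ : [set i | _] = set0) ?cards0 //.
by apply/setP=> i; rewrite !inE eqxx.
Qed.

Definition spg (G : sgraph) (a b : G) : sgraph :=
  SGraph (@spg_adj_sym G a b) (@spg_adj_irr G a b).

Definition shortest_path_graph (H : sgraph) : Prop :=
  exists (G : sgraph) (a b : G), a != b /\ graph_iso (spg a b) H.

Definition bip_adj (m n : nat) : rel ('I_m + 'I_n) := fun u v =>
  match u, v with inl _, inr _ | inr _, inl _ => true | _, _ => false end.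

Lemma bip_adj_sym (m n : nat) : symmetric (@bip_adj m n).
Proof. by case=> ? [?|?]. Qed.

Lemma bip_adj_irr (m n : nat) : irreflexive (@bip_adj m n).
Proof. by case. Qed.

Definition complete_bipartite (m n : nat) : sgraph :=
  SGraph (@bip_adj_sym m n) (@bip_adj_irr m n).

Definition claw : sgraph := complete_bipartite 1 3.

Definition induced_copy (F H : sgraph) (f : F -> H) : Prop :=
  injective f /\ forall x y, adj (f x) (f y) = adj x y.

Definition copy_edges (F H : sgraph) (f : F -> H) : {set {set H}} :=
  [set [set f u.1; f u.2] | u : F * F & adj u.1 u.2].

(* A 4-cycle is a subgraph, not necessarily induced, given by its vertices in
   cyclic order. *)
Definition four_cycle (H : sgraph) (c : seq H) : bool :=
  [&& size c == 4, cycle adj c & uniq c].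

Definition cycle_edges (H : sgraph) (c : seq H) : {set {set H}} :=
  [set [set x; next c x] | x in c].

(* Main.v *)
Require Import Defs.
From mathcomp Require Import all_boot.
From mathcomp Require Import zify.

Set Implicit Arguments.
Unset Strict Implicit.
Unset Printing Implicit Defensive.

(** The leaves of an induced claw in S(G,a,b) differ from the centre [u] in three
    distinct positions, since two leaves changing the same position would be
    adjacent.  Two of these positions are not consecutive, so the corresponding
    changes of [u] can be carried out simultaneously.  The result is again a
    shortest path, and it closes a 4-cycle with [u] and the two leaves. *)

Lemma spg_adjP (G : sgraph) (a b : G) (p q : spg a b) :
  reflect (exists i, forall k, (tnth (val p) k != tnth (val q) k) = (k == i))
          (adj p q).
Proof.
apply: (iffP cards1P) => -[i Hi]; exists i.
  by move=> k; move/setP/(_ k): Hi; rewrite !inE.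
by apply/setP=> k; rewrite !inE Hi.
Qed.

(** Shortening the walk gives an a,b-path, which has at least [dist a b] edges. So no vertex was
    dropped, and the walk had no repetition. *)
Lemma shortest_walk_ab_path (G : sgraph) (a b : G) (p : seq G) :
  path adj a p -> last a p = b -> size p <= dist a b -> ab_path a b (a :: p).
Proof.
move=> pP pb szp; rewrite /ab_path eqxx pP pb eqxx !andTb.
case/shortenP: pP pb => p' p'P up' subp pb.
have szp' : dist a b <= size p'.
  by apply: (@ab_path_dist_le _ _ _ (a :: p')); rewrite /ab_path eqxx p'P pb eqxx.
apply: (leq_size_uniq up').
  by move=> x; rewrite !inE => /orP[->|/subp ->]; rewrite ?orbT.
by rewrite ltnS (leq_trans szp szp').
Qed.

(** At length [dist a b] uniqueness comes for free, so a path modified at some positions only has to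
    be checked at its ends and on consecutive pairs. *)
Lemma ab_path_tnthP (G : sgraph) (a b : G) (t : (dist a b).+1.-tuple G) :
  reflect [/\ tnth t ord0 = a, tnth t ord_max = b
            & forall k l : 'I_(dist a b).+1, l = k.+1 :> nat ->
                adj (tnth t k) (tnth t l)]
          (ab_path a b t).
Proof.
apply: (iffP idP).
  case: t => -[//|x p] /= szp /and4P[/eqP xa /(pathP x) pP /eqP pb _].
  have szp' : size p = dist a b by move/eqP: (szp) => -[].
  split=> [||k l kl]; rewrite !(tnth_nth x) //=.
    by rewrite -szp' -last_nth.
  by rewrite kl; apply: pP; rewrite szp' -ltnS -kl.
case: t => -[//|x p] /= szp []; move/eqP: (szp) => -[szp'].
rewrite !(tnth_nth x) /= => xa.
rewrite -[X in nth _ _ X]szp' -last_nth /= => pb tP.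
subst x; apply: shortest_walk_ab_path; rewrite ?szp' //.
apply/(pathP a) => i; rewrite szp' => ilt.
by have := tP (Ordinal (ltnW ilt : i < _.+1)) (Ordinal (ilt : i.+1 < _.+1)) erefl;
   rewrite !(tnth_nth a).
Qed.

(** Since [i] and [j] are not consecutive, no edge of the combined path meets both changes: each
    edge is an edge of [x] or of [y]. *)
Lemma spg_square (G : sgraph) (a b : G) (u x y : spg a b)
    (i j : 'I_(dist a b).+1) :
  i.+1 < j ->
  (forall k, (tnth (val u) k != tnth (val x) k) = (k == i)) ->
  (forall k, (tnth (val u) k != tnth (val y) k) = (k == j)) ->
  exists w : spg a b, [/\ adj x w, adj w y & u != w].
Proof.
move=> ij ux uy.
have xu k : k != i -> tnth (val x) k = tnth (val u) k.
  by rewrite -ux negbK => /eqP.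
have yu k : k != j -> tnth (val y) k = tnth (val u) k.
  by rewrite -uy negbK => /eqP.
have neij : i != j by rewrite -val_eqE neq_ltn /= (ltnW ij).
(* This is [u] with both changes made, since [y] agrees with [u] away from [j]. *)
pose t := [tuple if k == i then tnth (val x) k else tnth (val y) k
            | k < (dist a b).+1].
have tE k : tnth t k = if k == i then tnth (val x) k else tnth (val y) k.
  by rewrite tnth_mktuple.
have tx k : k != j -> tnth t k = tnth (val x) k.
  by rewrite tE; case: (eqVneq k i) => // ki kj; rewrite yu // xu.
have ty k : k != i -> tnth t k = tnth (val y) k by rewrite tE => /negPf->.
have tP : ab_path a b t.
  have [x0 xm xP] := ab_path_tnthP _ (valP x).
  have [y0 ym yP] := ab_path_tnthP _ (valP y).
  apply/ab_path_tnthP; split=> [||k l kl].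
  - by rewrite tE x0 y0 if_same.
  - by rewrite tE xm ym if_same.
  (* One of [i], [j] avoids both [k] and [k.+1]. *)
  - have [/andP[ki li]|H] := boolP ((k != i) && (l != i)).
      by rewrite !ty //; apply: yP.
    have /andP[kj lj] : (k != j) && (l != j).
      by move: H; rewrite -!val_eqE /=; lia.
    by rewrite !tx //; apply: xP.
exists (exist _ t tP : spg a b); split.
- apply/spg_adjP; exists j => k /=.
  have [->|kj] := eqVneq k j; last by rewrite tx ?eqxx.
  by rewrite ty 1?eq_sym // xu 1?eq_sym // uy eqxx.
- apply/spg_adjP; exists i => k /=.
  have [->|ki] := eqVneq k i; last by rewrite ty ?eqxx.
  by rewrite tx // yu // eq_sym ux eqxx.
(* At position [i] the new path agrees with [x], which differs from [u] there. *)
- apply/eqP => /(congr1 (fun p : spg a b => tnth (val p) i)) /= /eqP.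
  by rewrite tx //; apply/negP; rewrite ux.
Qed.

(** The least and the greatest of three distinct naturals differ by at least 2. *)
Lemma three_positions_gap (h : 'I_3 -> nat) :
  injective h -> exists i j, (h i).+1 < h j.
Proof.
move=> hI.
pose i0 : 'I_3 := inord 0; pose i1 : 'I_3 := inord 1; pose i2 : 'I_3 := inord 2.
have ne (i j : 'I_3) : val i != val j -> h i != h j.
  by apply: contra => /eqP/hI->.
have n01 : h i0 != h i1 by apply: ne; rewrite /= !inordK.
have n02 : h i0 != h i2 by apply: ne; rewrite /= !inordK.
have n12 : h i1 != h i2 by apply: ne; rewrite /= !inordK.
have [|A] := ltnP (h i0).+1 (h i1); first by exists i0, i1.
have [|B] := ltnP (h i1).+1 (h i0); first by exists i1, i0.
have [|C] := ltnP (h i0).+1 (h i2); first by exists i0, i2.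
have [|D] := ltnP (h i2).+1 (h i0); first by exists i2, i0.
have [|E] := ltnP (h i1).+1 (h i2); first by exists i1, i2.
have [|F] := ltnP (h i2).+1 (h i1); first by exists i2, i1.
lia.
Qed.

Lemma spg_claw_square (G : sgraph) (a b : G) (f : claw -> spg a b) :
  induced_copy f ->
  exists (i j : 'I_3) (w : spg a b),
    [/\ i != j, adj (f (inr i)) w, adj w (f (inr j)) & f (inl ord0) != w].
Proof.
case=> fI fadj; pose u := f (inl ord0).
(* The body is boolean so that [xchoose] can select the position. *)
have leaf m : exists i,
    [forall k, (tnth (val u) k != tnth (val (f (inr m))) k) == (k == i)].
  have /spg_adjP[i Hi] : adj u (f (inr m)) by rewrite fadj.
  by exists i; apply/forallP => k; rewrite Hi.
pose h m := xchoose (leaf m).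
have hP m k : (tnth (val u) k != tnth (val (f (inr m))) k) = (k == h m).
  by have /forallP/(_ k)/eqP := xchooseP (leaf m).
(* Two leaves changing the same position agree with [u] elsewhere. If they also agree at that
   position they are equal, against injectivity of [f]; otherwise they are adjacent, against the
   claw being induced. *)
have hI : injective h.
  move=> m n hmn; apply/eqP/negPn/negP => nmn.
  have : ~~ adj (f (inr m)) (f (inr n)) by rewrite fadj.
  case/negP; apply/spg_adjP; exists (h m) => k.
  have [->|khm] := eqVneq k (h m).
    apply: contra nmn => /eqP e.
    have : f (inr m) = f (inr n).
      apply/val_inj/eq_from_tnth => l; have [->//|nl] := eqVneq l (h m).
      have := hP m l; have := hP n l; rewrite -hmn (negPf nl).
      by move=> /negbFE/eqP <- /negbFE/eqP <-.
    by case/fI => ->.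
  have := hP m k; have := hP n k; rewrite -hmn (negPf khm).
  by move=> /negbFE/eqP <- /negbFE/eqP <-; rewrite eqxx.
have [i [j ij]] := three_positions_gap (inj_comp val_inj hI).
have [w [xw wy uw]] := spg_square (ij : (h i).+1 < h j) (hP i) (hP j).
by exists i, j, w; split=> //; apply: contraTneq ij => ->; rewrite ltnNge leqnSn.
Qed.

(** The cycle runs through the centre, leaf [i], [w] and leaf [j]; the two edges at the centre
    belong to the claw. *)
Lemma claw_square_cycle (H : sgraph) (f : claw -> H) (i j : 'I_3) (w : H) :
  induced_copy f -> i != j -> adj (f (inr i)) w -> adj w (f (inr j)) ->
  f (inl ord0) != w ->
  exists c : seq H, four_cycle c /\ 2 <= #|cycle_edges c :&: copy_edges f|.
Proof.
case=> fI fadj ij xw wy uw.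
set u := f (inl ord0); set x := f (inr i); set y := f (inr j).
have ux : u != x by apply/eqP => /fI.
have uy : u != y by apply/eqP => /fI.
have xy : x != y by rewrite /x /y (inj_eq fI); apply: contra ij => /eqP[->].
have xnw : x != w by apply: contraTneq xw; rewrite -/x => ->; rewrite adj_irr.
have wny : w != y by apply: contraTneq wy; rewrite -/y => ->; rewrite adj_irr.
exists [:: u; x; w; y]; split.
  rewrite /four_cycle /= !inE !negb_or ux uy xy uw xnw wny xw wy /=.
  by rewrite /u /x /y !fadj.
have : [set [set u; x]; [set y; u]] \subset
       cycle_edges [:: u; x; w; y] :&: copy_edges f.
  apply/subsetP=> e; rewrite !inE => /orP[]/eqP->; apply/andP; split.
  - by apply/imsetP; exists u; rewrite ?inE ?eqxx //= eqxx.
  - by apply/imsetP; exists (inl ord0, inr i); rewrite ?inE.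
  - apply/imsetP; exists y; first by rewrite !inE eqxx !orbT.
    by rewrite /= !(eq_sym y) (negPf uy) (negPf xy) (negPf wny) eqxx.
  - by apply/imsetP; exists (inr j, inl ord0); rewrite ?inE.
move/subset_leq_card; apply: leq_trans; rewrite cards2.
(* The two edges are distinct because [x] lies only on the first. *)
suff -> : [set u; x] != [set y; u] by [].
by apply/eqP => /setP/(_ x); rewrite !inE eqxx orbT (eq_sym x u) (negPf ux) (negPf xy).
Qed.

Lemma claw_four_cycle_free (c : seq claw) : ~~ four_cycle c.
Proof.
case: c => [|x [|y [|z [|t []]]]] //; rewrite /four_cycle /= !inE.
(* The adjacencies alternate between the two sides, so the cycle visits the
   centre twice. *)
by case: x y z t => x [] y [] z [] t //=;
  rewrite ?[x]ord1 ?[y]ord1 ?[z]ord1 ?[t]ord1 ?eqxx ?orbT //= ?andbF.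
Qed.

Theorem theorem19 :
  (forall H : sgraph, shortest_path_graph H ->
   forall f : claw -> H, induced_copy f ->
   exists c : seq H,
     four_cycle c /\ 2 <= #|cycle_edges c :&: copy_edges f|)
  /\ ~ shortest_path_graph claw.
Proof.
have main (H : sgraph) : shortest_path_graph H ->
   forall f : claw -> H, induced_copy f ->
   exists c : seq H, four_cycle c /\ 2 <= #|cycle_edges c :&: copy_edges f|.
  case=> G [a [b [_ [g [[g' gK g'K] gadj]]]]] f fP.
  (* The claw is pulled back to the path graph along the inverse isomorphism; its square is then
     carried forward by [g]. *)
  have g'fP : induced_copy (g' \o f).
    split; first exact: inj_comp (can_inj g'K) fP.1.
    by move=> x y; rewrite -gadj /= !g'K fP.2.
  have [i [j [w [ij iw wj uw]]]] := spg_claw_square g'fP.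
  apply: (claw_square_cycle (i := i) (j := j) (w := g w)) => //.
  - by rewrite -[f _]g'K gadj.
  - by rewrite -[f (inr j)]g'K gadj.
  - by rewrite -[f _]g'K (can_eq gK).
split=> // clawP.
(* The identity is an induced copy of the claw in itself, so the claw would contain a 4-cycle. *)
have [|c [c4 _]] := main _ clawP id; first by split.
by have := claw_four_cycle_free c; rewrite c4.
Qed.
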